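(* Suppose $\tau$ is a probability measure satisfying $\tau(\mathbb{D})=1$ and let $\mu$ be a probability measure on the unit circle chosen randomly by selecting the sequence of Verblunsky coefficients $\{\alpha_n\}_{n\geq0}$ of $\mu$ as i.i.d. random variables with distribution $\tau$. Then almost surely it is true that for every $\nu$ in the class $K(\tau)$, there exists a subsequence $\{m_n\}_{n=1}^{\infty}\subseteq\mathbb{N}$ such that $$\lim_{n\to\infty}\left(\frac{p_{m_n-1}(z;\mu)}{p_{m_n}(z;\mu)}-\frac{p_{n-1}(z;\nu)}{p_{n}(z;\nu)}\right)=0,\qquad|z|>1.$$
   Context: $\mathbb{D}$ is the open unit disk in $\mathbb{C}$; $\tau$ is a Borel probability measure on $\mathbb{C}$ and $\mathrm{supp}(\tau)$ is its closed support. For a probability measure $\mu$ on $\mathbb{C}$ with compact and infinite support, $\{p_n(z;\mu)\}_{n\ge0}$ denotes the sequence of orthonormal polynomials: $p_n(\cdot;\mu)$ has degree $n$, positive leading coefficient $\kappa_n(\mu)$, and $\int p_n\overline{p_m}\,d\mu=\delta_{m,n}$; $P_n(z;\mu)=\kappa_n(\mu)^{-1}p_n(z;\mu)$ is the monic orthogonal polynomial. If $\mu$ is a probability measure on $\partial\mathbb{D}$ with infinite support, its Verblunsky coefficients $\{\alpha_n\}_{n\ge0}$ are defined by $P_n(0;\mu)=-\overline{\alpha}_{n-1}$, $n\ge1$; Verblunsky's Theorem says that this gives a one-to-one correspondence between sequences in $\mathbb{D}$ and probability measures on $\partial\mathbb{D}$ with infinite support. The class $K(\tau)$ is the set of all probability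 measures on the unit circle (with infinite support) whose Verblunsky coefficients are all contained in $\mathrm{supp}(\tau)\cap\mathbb{D}$. A subsequence $\{m_n\}\subseteq\mathbb{N}$ is strictly increasing. The almost sure event is one event on which the conclusion holds simultaneously for all $\nu\in K(\tau)$. *)

(* Defs.v *)
From HB Require Import structures.
From mathcomp Require Import all_boot all_order all_algebra.
From mathcomp Require Import all_classical all_reals all_analysis.
From mathcomp Require Import complex.

Set Implicit Arguments.
Unset Strict Implicit.
Unset Printing Implicit Defensive.

Import Order.TTheory GRing.Theory Num.Theory.
Import numFieldNormedType.Exports.

Local Open Scope classical_set_scope.
Local Open Scope ring_scope.

(* The complex numbers [R[i]] with the topology of the modulus and the Borel
   sigma-algebra. *)
HB.instance Definition _ (R : realType) := NormedModule.copy R[i] (R[i]^o).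
HB.instance Definition _ (R : realType) :=
  Measurable.copy R[i] (g_sigma_algebraType (@open R[i])).

Definition unit_disk {R : realType} : set R[i] := [set z | `|z| < 1].

Definition unit_circle {R : realType} : set R[i] := [set z | `|z| = 1].

Definition supp (R : realType) (mu : probability R[i] R) : set R[i] :=
  [set z | forall U : set R[i], open U -> U z -> (0 < mu U)%E].

Definition circle_measure (R : realType) (mu : probability R[i] R) : Prop :=
  mu unit_circle = 1%E /\ infinite_set (supp mu).

Definition Cintegral (R : realType) (mu : probability R[i] R)
    (f : R[i] -> R[i]) : R[i] :=
  Complex (\int[mu]_z complex.Re (f z)) (\int[mu]_z complex.Im (f z)).

(* In [R[i]], [0 < c] says that [c] is real and positive. *)
Definition orthonormal_polys (R : realType) (mu : probability R[i] R)
    (p : nat -> {poly R[i]}) : Prop :=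
  (forall n, size (p n) = n.+1 /\ 0 < lead_coef (p n)) /\
  (forall m n,
     Cintegral mu (fun z => (p n).[z] * ((p m).[z])^* ) = (m == n)%:R).

(* The orthonormal sequence exists and is unique when the support of [mu] is
   compact and infinite; the default [0] is a junk value for other [mu]. *)
Definition orthopoly (R : realType) (mu : probability R[i] R) :
    nat -> {poly R[i]} :=
  xget (fun=> 0) [set p | orthonormal_polys mu p].

Definition monic_orthopoly (R : realType) (mu : probability R[i] R) (n : nat) :
    {poly R[i]} :=
  (lead_coef (orthopoly mu n))^-1 *: orthopoly mu n.

(* [monic_orthopoly mu n.+1] takes the value [- (verblunsky mu n)^*] at [0]. *)
Definition verblunsky (R : realType) (mu : probability R[i] R) (n : nat) :
    R[i] :=
  - ((monic_orthopoly mu n.+1).[0])^*.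

Definition classK (R : realType) (tau : probability R[i] R) :
    set (probability R[i] R) :=
  [set nu | circle_measure nu /\
            forall n, (supp tau `&` unit_disk) (verblunsky nu n)].

Definition mutually_independent d d' (Omega : measurableType d)
    (T : measurableType d') (R : realType) (P : probability Omega R)
    (X : nat -> {RV P >-> T}) : Prop :=
  forall (J : seq nat) (A : nat -> set T),
    uniq J -> (forall j, measurable (A j)) ->
    P (\bigcap_(j in [set` J]) (X j @^-1` A j)) =
      (\prod_(j <- J) P (X j @^-1` A j))%E.

Definition iid_with_law d d' (Omega : measurableType d)
    (T : measurableType d') (R : realType) (P : probability Omega R)
    (tau : probability T R) (X : nat -> {RV P >-> T}) : Prop :=
  mutually_independent X /\
  forall n (A : set T), measurable A -> distribution P (X n) A = tau A.

(* Main.v *)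
Require Import Defs.
From HB Require Import structures.
From mathcomp Require Import all_boot all_order all_algebra.
From mathcomp Require Import all_classical all_reals all_analysis.
From mathcomp Require Import measurable_realfun.
From mathcomp Require Import complex.
From mathcomp Require Import ring.

Set Implicit Arguments.
Unset Strict Implicit.
Unset Printing Implicit Defensive.

Import Order.TTheory GRing.Theory Num.Theory.
Import numFieldNormedType.Exports.

Local Open Scope classical_set_scope.
Local Open Scope ring_scope.

(** Write Phi_n for the monic orthogonal polynomials of a measure on the circle
    and Psi_n for their reversals; these satisfy the Szego recurrence
      Phi_(n+1) = z Phi_n - conj(a_n) Psi_n,   Psi_(n+1) = Psi_n - a_n z Phi_n,
    with a_n the Verblunsky coefficients.  For |z| > 1 put w = 1/z and
    f_n = Psi_n(z) / Phi_n(z).  Then |f_n| <= 1, f_0 = 1, and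
      f_(n+1) = (w f_n - a_n) / (1 - conj(a_n) w f_n),
      p_n(z) / p_(n+1)(z) = sqrt(1 - |a_n|^2) w / (1 - conj(a_n) w f_n)
    ([circle_ratio]).  So p_n/p_(n+1) depends only on a_0, ..., a_n, and it
    forgets the remote past exponentially fast: the step f_n -> f_(n+1) is
    multiplication by w followed by an automorphism of the disk, hence a strict
    contraction of the hyperbolic metric, uniformly in the coefficient
    ([schur_iter_contract]).  Each step is also Lipschitz in f_n and in a_n with
    a constant depending only on |w|, because |1 - conj(a) w f| >= 1 - |w|
    ([schur_iter_dist]).  Consequently, if the coefficients of mu at the places
    M_k, ..., M_k + k agree with those of nu at the places 0, ..., k up to 1/k!,
    the two ratios with top coefficients a_(M_k + k) and b_k differ by a quantity
    that tends to 0: an error L^k / k! from the mismatch and an error |w|^k from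
    the different initial values ([ratio_step_cvg]).  The tolerance 1/k! beats
    L^k for every L, which is why one sequence M_k serves all z at once.

    It remains to find such M_k, almost surely and for all nu together.  A finite
    pattern of sets of positive tau-measure occurs infinitely often in an i.i.d.
    sequence, as disjoint blocks are independent trials with the same positive
    probability of success ([pattern_recurs]).  Countably many patterns, made of
    balls with rational centres, are enough: a point of supp(tau) lies in such
    balls of arbitrarily small radius, and each of them has positive measure
    because it is an open neighbourhood of that point ([supp_pattern_recurs]).

    The orthonormal polynomials are obtained algebraically, from a form on
    polynomials that is sesquilinear, Hermitian, positive definite and invariant
    under multiplication of both arguments by z.  For a measure on the circle
    invariance is |z|^2 = 1, and definiteness is the infiniteness of the support
    ([poly_form_gt0]). *)

(** * Backward Schur iteration *)

Section SchurIterates.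
Variable C : numClosedFieldType.
Implicit Types (w a b g h z : C) (n : nat).

(** With [w = z^-1], the step from [f_n = Psi_n(z) / Phi_n(z)] to [f_(n+1)] under
    the Szego recurrence with coefficient [a]: the inverse of a step of the Schur
    algorithm with parameter [- a], evaluated at the point [w]. *)
Definition schur_step w a g : C := (w * g - a) / (1 - a^* * (w * g)).

Fixpoint schur_iter w (a : nat -> C) n g : C :=
  if n is k.+1 then schur_step w (a k) (schur_iter w a k g) else g.

(** The value of [p_n(z) / p_(n+1)(z)] when [w = z^-1], [a = a_n], [g = f_n]. *)
Definition ratio_step w a g : C :=
  sqrtC (1 - `|a| ^+ 2) * w / (1 - a^* * (w * g)).

Lemma schur_iter_add w (a : nat -> C) M n g :
  schur_iter w a (M + n) g =
  schur_iter w (fun j => a (M + j)%N) n (schur_iter w a M g).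
Proof. by elim: n => [|n IH]; rewrite ?addn0// addnS /= IH. Qed.

Lemma schur_den_ge w a g : `|w| <= 1 -> `|a| <= 1 -> `|g| <= 1 ->
  1 - `|w| <= `|1 - a^* * (w * g)|.
Proof.
move=> w1 a1 g1; apply: le_trans (lerB_dist _ _).
rewrite normr1 !normrM norm_conjC lerD2l lerN2 mulrCA.
by rewrite ler_piMr ?mulr_ile1.
Qed.

Lemma schur_den_neq0 w a g : `|w| < 1 -> `|a| <= 1 -> `|g| <= 1 ->
  1 - a^* * (w * g) != 0.
Proof.
move=> w1 a1 g1; rewrite -normr_gt0.
by apply: lt_le_trans (schur_den_ge (ltW w1) a1 g1); rewrite subr_gt0.
Qed.

(** The identity [1 - |T u|^2 = (1 - |a|^2) (1 - |u|^2) / |1 - conj(a) u|^2] for the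
    disk automorphism [T u = (u - a) / (1 - conj(a) u)], at [u = w g]. *)
Lemma sub_sqnorm_schur_step w a g : 1 - a^* * (w * g) != 0 ->
  1 - `|schur_step w a g| ^+ 2 =
  (1 - `|a| ^+ 2) * (1 - `|w| ^+ 2 * `|g| ^+ 2) / `|1 - a^* * (w * g)| ^+ 2.
Proof.
move=> D0; rewrite /schur_step normf_div expr_div_n.
have N0 : `|1 - a^* * (w * g)| ^+ 2 != 0 by rewrite expf_neq0 ?normr_eq0.
apply: (mulIf N0); rewrite mulrBl !divfK // !normCK.
by rewrite !(rmorphB, rmorphM, rmorph1) /= conjCK; ring.
Qed.

Lemma sqnorm_le1 g : `|g| <= 1 -> `|g| ^+ 2 <= 1.
Proof. by move=> g1; rewrite expr_le1. Qed.

Lemma sub_sqnorm_gt0 w g : `|w| < 1 -> `|g| <= 1 -> 0 < 1 - `|w| ^+ 2 * `|g| ^+ 2.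
Proof.
move=> w1 g1; rewrite subr_gt0 -exprMn expr_lt1 ?mulr_ge0//.
by apply: le_lt_trans w1; rewrite ler_piMr.
Qed.

Lemma schur_step_lt1 w a g : `|w| < 1 -> `|a| < 1 -> `|g| <= 1 ->
  `|schur_step w a g| < 1.
Proof.
move=> w1 a1 g1; have D0 := schur_den_neq0 w1 (ltW a1) g1.
rewrite -(@expr_lt1 _ 2)// -subr_gt0 sub_sqnorm_schur_step//.
rewrite divr_gt0 ?exprn_gt0 ?normr_gt0// mulr_gt0 ?sub_sqnorm_gt0//.
by rewrite subr_gt0 expr_lt1.
Qed.

Lemma schur_iter_le1 w (a : nat -> C) n g : `|w| < 1 -> (forall k, `|a k| < 1) ->
  `|g| <= 1 -> `|schur_iter w a n g| <= 1.
Proof.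
by move=> w1 a1 g1; elim: n => //= n IH; apply/ltW/schur_step_lt1.
Qed.

(** The contraction behind the loss of memory.  On the open disk the quantity
    [|u - v|^2 / ((1 - |u|^2) (1 - |v|^2))] is a function of the hyperbolic distance,
    hence invariant under disk automorphisms; replacing [(u, v)] by [(w u, w v)]
    multiplies the numerator by [|w|^2] and increases the denominator.  Testing it
    at [(w g, w h)], and clearing the denominator, keeps everything finite when
    [|g|] or [|h|] equals 1, as happens for the initial value [f_0 = 1]. *)
Lemma schur_step_contract w a g h K :
    `|w| < 1 -> `|a| < 1 -> `|g| <= 1 -> `|h| <= 1 -> 0 <= K ->
    `|g - h| ^+ 2 <=
      K * ((1 - `|w| ^+ 2 * `|g| ^+ 2) * (1 - `|w| ^+ 2 * `|h| ^+ 2)) ->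
  `|schur_step w a g - schur_step w a h| ^+ 2 <= `|w| ^+ 2 * K *
      ((1 - `|w| ^+ 2 * `|schur_step w a g| ^+ 2) *
       (1 - `|w| ^+ 2 * `|schur_step w a h| ^+ 2)).
Proof.
move=> w1 a1 g1 h1 K0 gh; set g' := schur_step w a g.
set h' := schur_step w a h.
have Dg := schur_den_neq0 w1 (ltW a1) g1.
have Dh := schur_den_neq0 w1 (ltW a1) h1.
have X := sub_sqnorm_gt0 w1 g1; have Y := sub_sqnorm_gt0 w1 h1.
have sq_mono x : 1 - `|x| ^+ 2 <= 1 - `|w| ^+ 2 * `|x| ^+ 2.
  by rewrite lerD2l lerN2 ler_piMl ?exprn_ge0// sqnorm_le1// ltW.
have g'1 : 0 <= 1 - `|g'| ^+ 2.
  by rewrite subr_ge0 sqnorm_le1// ltW// schur_step_lt1.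
have h'1 : 0 <= 1 - `|h'| ^+ 2.
  by rewrite subr_ge0 sqnorm_le1// ltW// schur_step_lt1.
apply: (@le_trans _ _ (`|w| ^+ 2 * K * ((1 - `|g'| ^+ 2) * (1 - `|h'| ^+ 2)))).
  (* invariance under the automorphism, up to the factor `|w| ^+ 2 *)
  have E : `|g' - h'| ^+ 2 *
      ((1 - `|w| ^+ 2 * `|g| ^+ 2) * (1 - `|w| ^+ 2 * `|h| ^+ 2)) =
      `|w| ^+ 2 * `|g - h| ^+ 2 * ((1 - `|g'| ^+ 2) * (1 - `|h'| ^+ 2)).
    have -> : g' - h' = w * (g - h) * (1 - `|a| ^+ 2) /
        ((1 - a^* * (w * g)) * (1 - a^* * (w * h))).
      by rewrite /g' /h' /schur_step normCK; field; rewrite Dg Dh.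
    rewrite /g' /h' !sub_sqnorm_schur_step// !normf_div !normrM.
    rewrite [`|1 - _ ^+ 2|]ger0_norm; last by rewrite subr_ge0 sqnorm_le1// ltW.
    by field; rewrite !normr_eq0 Dg Dh.
  rewrite -(ler_pM2r (mulr_gt0 X Y)) E.
  rewrite [leRHS](_ : _ = `|w| ^+ 2 * (K * ((1 - `|w| ^+ 2 * `|g| ^+ 2) *
      (1 - `|w| ^+ 2 * `|h| ^+ 2))) * ((1 - `|g'| ^+ 2) * (1 - `|h'| ^+ 2)));
    last by ring.
  by rewrite ler_wpM2r ?mulr_ge0// ler_wpM2l ?exprn_ge0.
apply: ler_wpM2l; first by rewrite mulr_ge0 ?exprn_ge0.
exact: ler_pM.
Qed.

(** The factor 2 is the diameter of the disk, and [1 - |w|^2] bounds from below the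
    two weights of [schur_step_contract] at the start. *)
Lemma schur_iter_contract w (a : nat -> C) n g h :
    `|w| < 1 -> (forall k, `|a k| < 1) -> `|g| <= 1 -> `|h| <= 1 ->
  `|schur_iter w a n g - schur_iter w a n h| <= `|w| ^+ n * (2 / (1 - `|w| ^+ 2)).
Proof.
move=> w1 a1 g1 h1; have w2 : 0 < 1 - `|w| ^+ 2 by rewrite subr_gt0 expr_lt1.
have w2g (x : C) : `|x| <= 1 -> 1 - `|w| ^+ 2 <= 1 - `|w| ^+ 2 * `|x| ^+ 2.
  by move=> x1; rewrite lerD2l lerN2 ler_piMr ?exprn_ge0 ?sqnorm_le1.
pose K k := (`|w| ^+ k * (2 / (1 - `|w| ^+ 2))) ^+ 2.
have K0 k : 0 <= K k.
  by rewrite exprn_ge0// mulr_ge0 ?exprn_ge0// divr_ge0// ltW.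
have inv : `|schur_iter w a n g - schur_iter w a n h| ^+ 2 <=
    K n * ((1 - `|w| ^+ 2 * `|schur_iter w a n g| ^+ 2) *
           (1 - `|w| ^+ 2 * `|schur_iter w a n h| ^+ 2)).
  elim: n => [|n IH] /=.
    apply: (@le_trans _ _ (2 ^+ 2)).
      rewrite ler_pXn2r ?nnegrE//.
      by apply: le_trans (ler_normB _ _) _; rewrite -[2]/(1 + 1) lerD.
    rewrite /K mul1r expr_div_n -mulrA ler_peMr ?exprn_ge0//.
    rewrite mulrC ler_pdivlMr ?exprn_gt0// mul1r expr2.
    by apply: ler_pM; rewrite ?(ltW w2)// w2g.
  have -> : K n.+1 = `|w| ^+ 2 * K n by rewrite /K [`|w| ^+ n.+1]exprS -mulrA exprMn.
  by apply: schur_step_contract; rewrite ?schur_iter_le1.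
rewrite -(@ler_pXn2r _ 2)// ?nnegrE//; last first.
  by rewrite mulr_ge0 ?exprn_ge0// divr_ge0// ltW.
have bnd (x : C) : `|x| <= 1 -> 0 <= 1 - `|w| ^+ 2 * `|x| ^+ 2 <= 1.
  by move=> x1; rewrite (ltW (sub_sqnorm_gt0 w1 x1)) lerBlDr lerDl mulr_ge0 ?exprn_ge0.
have /andP[g0 g2] := bnd _ (schur_iter_le1 n w1 a1 g1).
have /andP[h0 h2] := bnd _ (schur_iter_le1 n w1 a1 h1).
by apply: le_trans inv _; rewrite -/(K n) ler_piMr// mulr_ile1.
Qed.

(** As [|N' / D'| <= 1], the error of the denominator enters with a factor at most 1,
    and [D] is the only denominator that has to be bounded from below. *)
Lemma quotient_dist s (N N' D D' e : C) : 0 < s -> s <= `|D| -> D' != 0 ->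
  `|N'| <= `|D'| -> `|N - N'| <= e -> `|D - D'| <= e ->
  `|N / D - N' / D'| <= 2 / s * e.
Proof.
move=> s0 sD D'0 ND' dN dD.
have D0 : 0 < `|D| by apply: lt_le_trans sD.
have D0' : D != 0 by rewrite -normr_gt0.
have -> : N / D - N' / D' = ((N - N') - (N' / D') * (D - D')) / D.
  by field; rewrite D0' D'0.
rewrite normf_div ler_pdivrMr//.
have e0 : 0 <= e by apply: le_trans dN.
apply: (@le_trans _ _ (2 * e)); last first.
  rewrite [leRHS](_ : _ = 2 * e * (`|D| / s)); last by ring.
  by rewrite ler_peMr ?mulr_ge0// ler_pdivlMr// mul1r.
apply: le_trans (ler_normB _ _) _; rewrite mulr_natl mulr2n lerD//.
rewrite normrM; apply: le_trans dD; rewrite ler_piMl//.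
by rewrite normf_div ler_pdivrMr ?normr_gt0// mul1r.
Qed.

Lemma schur_den_dist w a b g h : `|w| <= 1 -> `|a| <= 1 -> `|h| <= 1 ->
  `|a^* * (w * g) - b^* * (w * h)| <= `|g - h| + `|a - b|.
Proof.
move=> w1 a1 h1.
have -> : a^* * (w * g) - b^* * (w * h) =
    a^* * w * (g - h) + (a - b)^* * w * h by rewrite rmorphB /=; ring.
apply: le_trans (ler_normD _ _) _.
rewrite !normrM !norm_conjC lerD//; last first.
  by rewrite -mulrA ler_piMr// mulr_ile1.
by rewrite ler_piMl// mulr_ile1.
Qed.

Lemma schur_step_dist w a b g h : `|w| < 1 -> `|a| < 1 -> `|b| < 1 ->
  `|g| <= 1 -> `|h| <= 1 ->
  `|schur_step w a g - schur_step w b h| <=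
     2 / (1 - `|w|) * (`|g - h| + `|a - b|).
Proof.
move=> w1 a1 b1 g1 h1.
have Dh := schur_den_neq0 w1 (ltW b1) h1.
apply: quotient_dist => //; rewrite ?subr_gt0//.
- by apply: schur_den_ge => //; apply: ltW.
- have := ltW (schur_step_lt1 w1 b1 h1).
  by rewrite normf_div ler_pdivrMr ?normr_gt0// mul1r.
- rewrite [X in `|X|](_ : _ = w * (g - h) - (a - b)); last by ring.
  apply: le_trans (ler_normB _ _) _; rewrite lerD2r normrM.
  by rewrite ler_piMl// ltW.
rewrite [X in `|X|](_ : _ = - (a^* * (w * g) - b^* * (w * h))); last by ring.
by rewrite normrN schur_den_dist// ltW.
Qed.

(** Iterating [schur_step_dist] from a common start: with [L = 2 / (1 - |w|) >= 1],
    the errors satisfy [e_(k+1) <= L (e_k + e)], whence [e_k <= (2 L)^k e]. *)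
Lemma schur_iter_dist w (a b : nat -> C) n g e : `|w| < 1 ->
  (forall k, `|a k| < 1) -> (forall k, `|b k| < 1) -> `|g| <= 1 -> 0 <= e ->
  (forall k, (k < n)%N -> `|a k - b k| <= e) ->
  `|schur_iter w a n g - schur_iter w b n g| <= (4 / (1 - `|w|)) ^+ n * e.
Proof.
move=> w1 a1 b1 g1 e0; have s0 : 0 < 1 - `|w| by rewrite subr_gt0.
have L1 : 1 <= 4 / (1 - `|w|).
  have w_le1 : 1 - `|w| <= 1 by rewrite lerBlDr lerDl.
  by rewrite ler_pdivlMr// mul1r (le_trans w_le1)// ler1n.
elim: n => [|n IH] ab /=; first by rewrite subrr normr0 mul1r.
apply: le_trans (schur_step_dist _ _ _ _ _) _; rewrite ?schur_iter_le1//.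
rewrite [leRHS](_ : _ = 2 / (1 - `|w|) * (2 * ((4 / (1 - `|w|)) ^+ n * e))).
  rewrite ler_wpM2l ?divr_ge0 ?(ltW s0)// mulr_natl mulr2n lerD//.
    by apply: IH => k kn; apply: ab; apply: ltnW.
  by apply: le_trans (ab n _) _ => //; rewrite ler_peMl// exprn_ege1.
by rewrite exprS; field; rewrite gt_eqF.
Qed.

Lemma sqrtC_dist (x y : C) : 0 <= x -> 0 <= y ->
  `|sqrtC x - sqrtC y| ^+ 2 <= `|x - y|.
Proof.
move=> x0 y0; rewrite -{2}[x]sqrtCK -{2}[y]sqrtCK subr_sqr normrM expr2.
rewrite ler_wpM2l// [leRHS]ger0_norm ?addr_ge0 ?sqrtC_ge0//.
by apply: le_trans (ler_normB _ _) _; rewrite !ger0_norm ?sqrtC_ge0.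
Qed.

(** The square root is only Holder continuous of exponent 1/2 as [|a|] tends
    to 1, which accounts for the term [sqrtC (2 * e)]; an estimate linear
    in [e] cannot be uniform in [a] and [b]. *)
Lemma ratio_step_dist w a b g h e : `|w| < 1 -> `|a| < 1 -> `|b| < 1 ->
  `|g| <= 1 -> `|h| <= 1 -> `|a - b| <= e -> `|g - h| <= e ->
  `|ratio_step w a g - ratio_step w b h| <=
     2 / (1 - `|w|) ^+ 2 * (sqrtC (2 * e) + e).
Proof.
move=> w1 a1 b1 g1 h1 abe ghe; have s0 : 0 < 1 - `|w| by rewrite subr_gt0.
have e0 : 0 <= e by apply: le_trans abe.
have Dg := schur_den_neq0 w1 (ltW a1) g1.
have Dh := schur_den_neq0 w1 (ltW b1) h1.
have dg := schur_den_ge (ltW w1) (ltW a1) g1.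
have dh := schur_den_ge (ltW w1) (ltW b1) h1.
have sub_ge0 (c : C) : `|c| < 1 -> 0 <= 1 - `|c| ^+ 2.
  by move=> c1; rewrite subr_ge0 sqnorm_le1// ltW.
have rho : `|sqrtC (1 - `|a| ^+ 2) - sqrtC (1 - `|b| ^+ 2)| <= sqrtC (2 * e).
  rewrite -(@ler_pXn2r _ 2)// ?nnegrE ?sqrtC_ge0 ?mulr_ge0// sqrtCK.
  apply: le_trans (sqrtC_dist (sub_ge0 _ a1) (sub_ge0 _ b1)) _.
  rewrite opprB addrC addrA subrK distrC subr_sqr normrM mulrC.
  apply: ler_pM => //.
    by apply: le_trans (ler_normD _ _) _; rewrite !normr_id -[2]/(1 + 1) lerD ?ltW.
  exact: le_trans (ler_dist_dist _ _) abe.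
have rhob : `|sqrtC (1 - `|b| ^+ 2)| <= 1.
  rewrite ger0_norm ?sqrtC_ge0 ?sub_ge0// -(@ler_pXn2r _ 2)//
    ?nnegrE ?sqrtC_ge0 ?sub_ge0//.
  by rewrite sqrtCK expr1n lerBlDr lerDl exprn_ge0.
rewrite /ratio_step.
set x := sqrtC _ in rho *; set y := sqrtC _ in rho rhob *.
set D := 1 - _ in Dg dg *; set E := 1 - _ in Dh dh *.
have -> : x * w / D - y * w / E = w * ((x - y) * E - y * (D - E)) / (D * E).
  by field; rewrite Dg Dh.
rewrite normf_div ler_pdivrMr ?normr_gt0 ?mulf_neq0//.
apply: (@le_trans _ _ (2 * (sqrtC (2 * e) + e))); last first.
  rewrite -mulrA [leRHS](_ : _ = 2 * (sqrtC (2 * e) + e) *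
    (`|D * E| / (1 - `|w|) ^+ 2)); last by ring.
  rewrite ler_peMr ?mulr_ge0 ?addr_ge0 ?sqrtC_ge0 ?mulr_ge0//.
  by rewrite ler_pdivlMr ?exprn_gt0// mul1r normrM expr2 ler_pM// ltW.
rewrite normrM; apply: (@le_trans _ _ (1 * (2 * (sqrtC (2 * e) + e))));
  last by rewrite mul1r.
apply: ler_pM => //; first exact: ltW.
apply: le_trans (ler_normB _ _) _; rewrite [leRHS]mulrDr lerD//.
  rewrite normrM mulrC ler_pM//; apply: le_trans (ler_normB _ _) _.
  rewrite normr1 -[2]/(1 + 1) lerD2l !normrM norm_conjC.
  by rewrite mulr_ile1 ?mulr_ge0 ?(ltW b1)// mulr_ile1 ?(ltW w1).
rewrite normrM -[leRHS]mul1r ler_pM//.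
rewrite [X in `|X|](_ : _ = - (a^* * (w * g) - b^* * (w * h)));
  last by rewrite /D /E; ring.
rewrite normrN; apply: le_trans (schur_den_dist _ _ (ltW w1) (ltW a1) h1) _.
by rewrite mulr_natl mulr2n lerD.
Qed.
End SchurIterates.

(** * The Szego recurrence for a Hermitian form on polynomials *)

Lemma sub_monic_size (R : nzRingType) n (f q : {poly R}) :
  f \is monic -> size f = n.+1 -> (size q <= n.+1)%N -> (size (q - q`_n *: f)%R <= n)%N.
Proof.
move=> mf sf sq; apply/leq_sizeP => j; rewrite leq_eqVlt => /predU1P[<-|nj].
  rewrite coefB coefZ; have -> : f`_n = 1.
    by have /monicP := mf; rewrite lead_coefE sf.
  by rewrite mulr1 subrr.
by rewrite coefB coefZ [q`_j]nth_default ?(leq_trans sq)// [f`_j]nth_default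
  ?sf// mulr0 subrr.
Qed.

Lemma size_1DXM (R : nzRingType) n (r : {poly R}) :
  (size r <= n)%N -> (size (1 + 'X * r)%R <= n.+1)%N.
Proof.
move=> szr; rewrite -commr_polyX -[1]polyC1 addrC size_MXaddC.
by case: ifP.
Qed.

Section Szego.
Variables (C : numClosedFieldType) (B : {poly C} -> {poly C} -> C).
Implicit Types p q r f : {poly C}.
Hypothesis Blin : forall c (p q r : {poly C}), B (c *: p + q) r = c * B p r + B q r.
Hypothesis Bherm : forall p q : {poly C}, B q p = (B p q)^*.
Hypothesis Bpos : forall p : {poly C}, p != 0 -> 0 < B p p.
Hypothesis BX : forall p q : {poly C}, B ('X * p) ('X * q) = B p q.

Lemma form0l r : B 0 r = 0.
Proof.
by have /eqP := Blin 1 0 0 r; rewrite scaler0 addr0 mul1r -subr_eq subrr eq_sym => /eqP.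
Qed.

Lemma formDl p q r : B (p + q) r = B p r + B q r.
Proof. by rewrite -[p in LHS]scale1r Blin mul1r. Qed.

Lemma formZl c p r : B (c *: p) r = c * B p r.
Proof. by rewrite -[c *: p]addr0 Blin form0l addr0. Qed.

Lemma formBl p q r : B (p - q) r = B p r - B q r.
Proof. by rewrite formDl -scaleN1r formZl mulN1r. Qed.

Lemma formDr p q r : B r (p + q) = B r p + B r q.
Proof. by rewrite Bherm formDl rmorphD /= -!Bherm. Qed.

Lemma formZr c p r : B r (c *: p) = c^* * B r p.
Proof. by rewrite Bherm formZl rmorphM /= -Bherm. Qed.

Lemma formBr p q r : B r (p - q) = B r p - B r q.
Proof. by rewrite formDr -scaleN1r formZr rmorphN rmorph1 mulN1r. Qed.

Lemma form_orthC p q : B p q = 0 -> B q p = 0.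
Proof. by move=> pq; rewrite Bherm pq rmorph0. Qed.

(** The pair [(Phi_n, Psi_n)] of a monic orthogonal polynomial and its reversal,
    generated together, the Verblunsky coefficient being read off from the form.
    Generating [Psi_n] by its own recurrence avoids handling reversed
    polynomials. *)
Fixpoint szego n : {poly C} * {poly C} :=
  if n is k.+1 then
    let: (F, G) := szego k in
    let c := B ('X * F) 1 / B F F in
    ('X * F - c *: G, G - c^* *: ('X * F))
  else (1, 1).

Let F n := (szego n).1.
Let G n := (szego n).2.

Definition szego_coef n : C := (B ('X * F n) 1 / B (F n) (F n))^*.

Lemma szegoS1 n : F n.+1 = 'X * F n - (szego_coef n)^* *: G n.
Proof. by rewrite /szego_coef conjCK /F /G /=; case: (szego n). Qed.

Lemma szegoS2 n : G n.+1 = G n - szego_coef n *: ('X * F n).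
Proof. by rewrite /szego_coef /F /G /=; case: (szego n). Qed.

(** The two families are characterized by orthogonality: [Phi_n] to
    [1, ..., z^(n-1)], and [Psi_n], normalized to be 1 at 0, to [z, ..., z^n]; the
    norms agree.  In the induction step only two orthogonality relations are
    new.  That of [Phi_(n+1)] to [1] is the choice of the coefficient.  That of
    [Psi_(n+1)] to [z^(n+1)] follows from [<Psi_n, z Phi_n> = a_n |Phi_n|^2], that
    is, from the same choice, since [<z Phi_n, Psi_n> = <z Phi_n, 1>]. *)
Lemma szego_invariants n :
  [/\ F n \is monic /\ size (F n) = n.+1,
      forall r : {poly C}, (size r <= n)%N -> B (F n) r = 0,
      exists2 r : {poly C}, (size r <= n)%N & G n = 1 + 'X * r,
      forall r : {poly C}, (size r <= n)%N -> B (G n) ('X * r) = 0 &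
      B (G n) (G n) = B (F n) (F n)].
Proof.
elim: n => [|n [[monF szF] orF [r0 szr0 Gr0] orG normG]].
  split=> //; rewrite ?monic1 ?size_poly1//.
  - by move=> r; rewrite leqn0 size_poly_eq0 => /eqP->; rewrite Bherm form0l rmorph0.
  - by exists 0; rewrite ?size_poly0// mulr0 addr0.
  - move=> r; rewrite leqn0 size_poly_eq0 => /eqP->.
    by rewrite mulr0 Bherm form0l rmorph0.
have N0 : B (F n) (F n) != 0 by rewrite gt_eqF// Bpos// monic_neq0.
have aE : (szego_coef n)^* * B (F n) (F n) = B ('X * F n) 1.
  by rewrite conjCK divfK.
have G1 : B (G n) 1 = B (F n) (F n).
  by rewrite -normG {3}Gr0 formDr orG// addr0.
have FG : B ('X * F n) (G n) = B ('X * F n) 1.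
  by rewrite Gr0 formDr BX orF// addr0.
have GF : B (G n) ('X * F n) = szego_coef n * B (F n) (F n).
  rewrite Bherm FG -aE rmorphM /= conjCK; congr (_ * _).
  by rewrite -Bherm.
have orF' (r : {poly C}) : (size r <= n.+1)%N -> B (F n.+1) r = 0.
  move=> szr; rewrite szegoS1 formBl formZl.
  (* split off the constant term, the only place where the coefficient matters *)
  elim/poly_ind: r szr => [|r c _] szr.
    by rewrite Bherm form0l [B _ 0]Bherm form0l rmorph0 mulr0 subrr.
  have szr' : (size r <= n)%N.
    by move: szr; rewrite size_MXaddC; case: eqP => [->|//]; rewrite size_poly0.
  rewrite -alg_polyC [r * 'X]mulrC !formDr !formZr BX orF// orG// !add0r G1.
  by rewrite mulrCA aE subrr.
have orG' (r : {poly C}) : (size r <= n.+1)%N -> B (G n.+1) ('X * r) = 0.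
  move=> szr; have szr' := sub_monic_size monF szF szr.
  (* split off the leading term along F n rather than along 'X^n *)
  rewrite -[r](subrK (r`_n *: F n)) mulrDr formDr szegoS2.
  rewrite !formBl !formZl -scalerAr !formZr !BX orG// orF// GF.
  by rewrite mulrCA !subrr mulr0 subrr addr0.
have FF1 : B (F n.+1) (F n.+1) = B (F n) (F n) - (szego_coef n)^* * B (G n) ('X * F n).
  have /form_orthC FGn : B (F n.+1) (G n) = 0.
    by apply: orF'; rewrite Gr0 size_1DXM.
  rewrite {2}szegoS1 formBr formZr (form_orthC FGn) mulr0 subr0.
  by rewrite szegoS1 formBl formZl BX.
have GG1 : B (G n.+1) (G n.+1) = B (G n) (G n) - szego_coef n * B ('X * F n) (G n).
  rewrite {2}szegoS2 formBr formZr orG' ?szF// mulr0 subr0.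
  by rewrite szegoS2 formBl formZl.
have szXF : size ('X * F n) = n.+2 by rewrite mulrC size_mulX ?szF ?monic_neq0.
have szZ c : (size (c *: G n)%R < size ('X * F n)%R)%N.
  by rewrite szXF ltnS (leq_trans (size_scale_leq _ _))// Gr0 size_1DXM.
split=> //.
- rewrite szegoS1 -scaleNr; split; last by rewrite size_polyDl.
  by rewrite monicE lead_coefDl// mulrC lead_coefMX.
- exists (r0 - szego_coef n *: F n).
    rewrite (leq_trans (size_polyD _ _))// geq_max size_polyN leqW//=.
    by rewrite (leq_trans (size_scale_leq _ _))// szF.
  by rewrite szegoS2 Gr0 mulrBr addrA -scalerAr.
- by rewrite FF1 GG1 normG FG GF -aE; ring.
Qed.

Lemma szego_norm_gt0 n : 0 < B (F n) (F n).
Proof. by have [[mF _] _ _ _ _] := szego_invariants n; rewrite Bpos// monic_neq0. Qed.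

(** Pythagoras in [z Phi_n = Phi_(n+1) + conj(a_n) Psi_n], multiplication by [z]
    being isometric and [Psi_n] having the norm of [Phi_n]. *)
Lemma szego_norm n : B (F n.+1) (F n.+1) =
  (1 - `|szego_coef n| ^+ 2) * B (F n) (F n).
Proof.
have [[mF sF] orF [r0 szr0 Gr0] orG normG] := szego_invariants n.
have [[_ _] orF1 _ _ _] := szego_invariants n.+1.
have aE : (szego_coef n)^* * B (F n) (F n) = B ('X * F n) 1.
  by rewrite conjCK divfK// gt_eqF ?szego_norm_gt0.
have FGn : B (F n.+1) (G n) = 0.
  by apply: orF1; rewrite Gr0 size_1DXM.
rewrite {2}szegoS1 formBr formZr FGn mulr0 subr0 szegoS1 formBl formZl BX.
rewrite [B (G n) _]Bherm Gr0 formDr BX [B _ r0]orF// addr0 -aE rmorphM /= conjCK -Bherm.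
by rewrite normCK; ring.
Qed.

Lemma szego_at0 n : (F n.+1).[0] = - (szego_coef n)^*.
Proof.
have [_ _ [r _ Gr] _ _] := szego_invariants n.
by rewrite szegoS1 Gr !hornerE; ring.
Qed.

Definition form_orthonormal (p : nat -> {poly C}) : Prop :=
  (forall n, size (p n) = n.+1 /\ 0 < lead_coef (p n)) /\
  (forall m n, B (p n) (p m) = (m == n)%:R).

Lemma orthonormal_exists : exists p : nat -> {poly C}, form_orthonormal p.
Proof.
pose k n := (sqrtC (B (F n) (F n)))^-1.
have k0 n : 0 < k n by rewrite invr_gt0 sqrtC_gt0 szego_norm_gt0.
have orF m n : (m < n)%N -> B (F n) (F m) = 0.
  move=> mn; have [_ orF _ _ _] := szego_invariants n; apply: orF.
  by have [[_ ->] _ _ _ _] := szego_invariants m.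
exists (fun n => k n *: F n); split=> [n|m n].
  have [[/monicP mF sF] _ _ _ _] := szego_invariants n.
  by rewrite size_scale ?gt_eqF// lead_coefZ mF mulr1.
rewrite formZl formZr; case: ltngtP => [mn|nm|->].
- by rewrite orF// !mulr0.
- by rewrite (form_orthC (orF _ _ nm)) !mulr0.
rewrite (conj_Creal (gtr0_real (k0 n))) mulrA -expr2 exprVn sqrtCK.
by rewrite mulVf// gt_eqF// szego_norm_gt0.
Qed.

Section Orthonormal.
Variable p : nat -> {poly C}.
Hypothesis onp : form_orthonormal p.

Lemma orthonormal_lead_gt0 n : 0 < lead_coef (p n).
Proof. by have [/(_ n)[]] := onp. Qed.

(** Uniqueness of the orthonormal sequence.  By strong induction the [p k], [k < n],
    are nonzero multiples of the [F k]; the difference [q] of [p n] and the multiple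
    of [F n] with the same leading coefficient is orthogonal to all of them, and if
    it had degree [k < n] its product with [F k] would not vanish. *)
Lemma orthonormalE n : p n = lead_coef (p n) *: F n.
Proof.
have [pP onpP] := onp.
have [m nm] := ubnP n; elim: m => // m IH in n nm *.
have [szp _] := pP n; have [[mF sF] orF _ _ _] := szego_invariants n.
pose q := p n - lead_coef (p n) *: F n.
have szq : (size q <= n)%N.
  by rewrite /q lead_coefE szp sub_monic_size// szp.
apply/eqP; rewrite -subr_eq0 -/q -size_poly_eq0.
have orq k : (k < n)%N -> B q (F k) = 0.
  move=> kn; have [_ lk0] := pP k.
  have : B q (p k) = 0.
    rewrite formBl formZl onpP (ltn_eqF kn) orF ?mulr0 ?subrr//.
    by have [-> _] := pP k.
  rewrite IH; last by rewrite (leq_trans kn).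
  rewrite formZr => /eqP; rewrite mulf_eq0 conjC_eq0 gt_eqF//= => /eqP->//.
case E : (size q) => [//|k].
have kn : (k < n)%N by rewrite -E.
have [[mFk sFk] orFk _ _ _] := szego_invariants k.
have := orq _ kn; rewrite -[q](subrK (q`_k *: F k)) formDl formZl.
rewrite [B (q - _) _]form_orthC ?add0r; last first.
  by apply: orFk; rewrite sub_monic_size// E.
move=> /eqP; rewrite mulf_eq0 [B _ _ == 0]gt_eqF ?szego_norm_gt0// orbF => /eqP q0.
have : lead_coef q = 0 by rewrite lead_coefE E.
by move=> /eqP; rewrite lead_coef_eq0 -size_poly_eq0 E.
Qed.

Lemma orthonormal_verblunsky n :
  - (((lead_coef (p n.+1))^-1 *: p n.+1).[0])^* = szego_coef n.
Proof.
rewrite [X in _ *: X]orthonormalE scalerA mulVf ?gt_eqF ?orthonormal_lead_gt0//.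
by rewrite scale1r szego_at0 rmorphN conjCK opprK.
Qed.

(** The squared leading coefficients are the inverses of the numbers [B (F n) (F n)],
    so this is the square root of [szego_norm]. *)
Lemma orthonormal_lead n : lead_coef (p n) = lead_coef (p n.+1) *
  sqrtC (1 - `|szego_coef n| ^+ 2).
Proof.
have lN k : lead_coef (p k) ^+ 2 * B (F k) (F k) = 1.
  have [_ /(_ k k)] := onp; rewrite eqxx -[true%:R]/(1 : C) => <-.
  rewrite [in RHS]orthonormalE formZl formZr.
  by rewrite (conj_Creal (gtr0_real (orthonormal_lead_gt0 k))) mulrA.
have N0 := szego_norm_gt0 n.
have a1 : 0 < 1 - `|szego_coef n| ^+ 2.
  by have := szego_norm_gt0 n.+1; rewrite szego_norm pmulr_lgt0.
apply/eqP; rewrite -(@eqrXn2 _ 2) ?mulr_ge0 ?sqrtC_ge0 ?ltW ?orthonormal_lead_gt0//.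
rewrite exprMn sqrtCK; apply/eqP/(mulIf (lt0r_neq0 N0)).
by rewrite lN -mulrA -szego_norm lN.
Qed.

Lemma szegoS1_at z n (f : C) : z != 0 -> (G n).[z] = f * (F n).[z] ->
  (F n.+1).[z] = z * (F n).[z] * (1 - (szego_coef n)^* * (z^-1 * f)).
Proof.
move=> z0 GE; rewrite szegoS1 hornerD hornerN hornerZ hornerM hornerX GE.
by move: (szego_coef n)^* => c; field.
Qed.

(** Zeros of [Phi_n] lie in the disk, so the quotient [f_n] makes sense for [|z| > 1];
    this and the bound [|f_n| <= 1] are proved together, as each step of the one
    uses the other. *)
Lemma szego_schur z n : 1 < `|z| -> (forall k, `|szego_coef k| < 1) ->
  (F n).[z] != 0 /\
  (G n).[z] = schur_iter z^-1 szego_coef n 1 * (F n).[z].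
Proof.
move=> z1 a1; have z0 : z != 0 by rewrite -normr_gt0 (lt_trans _ z1).
have w1 : `|z^-1| < 1 by rewrite normfV invf_lt1// (lt_trans _ z1).
elim: n => [|n [F0 GE]]; first by rewrite /F /G /= !hornerE oner_eq0.
set f := schur_iter _ _ n 1 in GE.
have f1 : `|f| <= 1 by apply: schur_iter_le1; rewrite ?normr1.
have D0 := schur_den_neq0 w1 (ltW (a1 n)) f1.
have FE := szegoS1_at z0 GE.
split; first by rewrite FE !mulf_neq0.
rewrite FE szegoS2 hornerD hornerN hornerZ hornerM hornerX GE /= -/f /schur_step.
by rewrite [RHS]mulrA [RHS]mulrAC divfK//; move: (szego_coef n) => c; field.
Qed.

Lemma orthonormal_ratio z n : 1 < `|z| -> (forall k, `|szego_coef k| < 1) ->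
  (p n).[z] / (p n.+1).[z] =
  ratio_step z^-1 (szego_coef n) (schur_iter z^-1 szego_coef n 1).
Proof.
move=> z1 a1; have z0 : z != 0 by rewrite -normr_gt0 (lt_trans _ z1).
have w1 : `|z^-1| < 1 by rewrite normfV invf_lt1// (lt_trans _ z1).
have [F0 GE] := szego_schur n z1 a1.
set f := schur_iter _ _ n 1 in GE *.
have f1 : `|f| <= 1 by apply: schur_iter_le1; rewrite ?normr1.
have D0 := schur_den_neq0 w1 (ltW (a1 n)) f1.
have FE := szegoS1_at z0 GE.
have D1 : z - (szego_coef n)^* * f != 0.
  rewrite (_ : _ - _ = z * (1 - (szego_coef n)^* * (z^-1 * f))) ?mulf_neq0//.
  by move: (szego_coef n)^* => c; field.
have l0 : lead_coef (p n.+1) != 0 by rewrite gt_eqF ?orthonormal_lead_gt0.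
rewrite [p n]orthonormalE [p n.+1]orthonormalE !hornerZ FE orthonormal_lead.
rewrite /ratio_step; move: (szego_coef n) D0 D1 => c D0 D1; field.
by rewrite l0 z0 F0 D1.
Qed.
End Orthonormal.
End Szego.

(** * Polynomials in L2 of a measure on the unit circle *)

Section CircleMeasure.
Variable R : realType.
Local Notation C := R[i].

Lemma continuous_mul_complex (f g : C -> C) :
  continuous f -> continuous g -> continuous (fun z => f z * g z).
Proof. move=> cf cg z; exact: cvgM (cf z) (cg z). Qed.

Lemma continuous_add_complex (f g : C -> C) :
  continuous f -> continuous g -> continuous (fun z => f z + g z).
Proof. move=> cf cg z; exact: cvgD (cf z) (cg z). Qed.

Lemma continuous_conjC : continuous (fun z : C => z^* ).
Proof.
move=> z U /nbhs_normP[e e0 eU]; apply/nbhs_normP; exists e => //= t zt.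
by apply: eU => /=; rewrite -rmorphB norm_conjC.
Qed.

Lemma continuous_Re : continuous (@complex.Re R : C -> R).
Proof.
move=> z U /nbhs_normP[e e0 eU].
apply/nbhs_normP; exists (e%:C)%C => /=; first by rewrite ltcR.
move=> t zt; apply: eU => /=; rewrite -ltcR -raddfB.
exact: le_lt_trans (normc_ge_Re _) zt.
Qed.

Lemma open_measurable_complex (U : set C) : open U -> measurable U.
Proof. exact: sub_sigma_algebra. Qed.

Lemma continuous_measurable_complex (f : C -> R) :
  continuous f -> measurable_fun setT f.
Proof.
move=> /continuousP cf.
apply: (measurability _ (RGenOpens.measurableE R)).
move=> _ [_ [a [b ->] <-]]; rewrite setTI.
by apply: open_measurable_complex; apply: cf; exact: interval_open.
Qed.

Lemma measurable_circle : measurable (@unit_circle R).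
Proof.
have cn : continuous (fun z : C => complex.Re `|z|).
  move=> z; apply: (@continuous_comp _ _ _ (fun z : C => `|z|));
    last exact: continuous_Re.
  exact: norm_continuous.
rewrite (_ : unit_circle = (fun z : C => complex.Re `|z|) @^-1` [set 1]).
  rewrite -[_ @^-1` _]setTI.
  by apply: continuous_measurable_complex => //; exact: measurable_set1.
apply/seteqP; split=> z; rewrite /preimage /unit_circle /mkset; first by move->.
by rewrite !normc_def => /= ->.
Qed.

Lemma nonneg_ReK (x : C) : 0 <= x -> ((complex.Re x)%:C)%C = x.
Proof. by case: x => a b; rewrite lecE /= => /andP[/eqP-> _]. Qed.

(** Enough for integrability when the measure is carried by the circle, although a
    polynomial is unbounded on the plane. *)
Definition circle_tame (f : C -> C) :=
  continuous f /\ exists M : C, forall z, `|z| = 1 -> `|f z| <= M.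

Lemma tameM f g : circle_tame f -> circle_tame g -> circle_tame (fun z => f z * g z).
Proof.
move=> [cf [M fM]] [cg [N gN]]; split; first exact: continuous_mul_complex.
by exists (M * N) => z z1; rewrite normrM ler_pM ?fM ?gN.
Qed.

Lemma tameD f g : circle_tame f -> circle_tame g -> circle_tame (fun z => f z + g z).
Proof.
move=> [cf [M fM]] [cg [N gN]]; split; first exact: continuous_add_complex.
by exists (M + N) => z z1; rewrite (le_trans (ler_normD _ _))// lerD ?fM ?gN.
Qed.

Lemma tame_conj f : circle_tame f -> circle_tame (fun z => (f z)^* ).
Proof.
move=> [cf [M fM]]; split; last by exists M => z z1; rewrite norm_conjC fM.
by move=> z; apply: (@continuous_comp _ _ _ f); [exact: cf|exact: continuous_conjC].
Qed.

Lemma tame_cst c : circle_tame (fun=> c).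
Proof. by split; [exact: cst_continuous|exists `|c|]. Qed.

Lemma tame_horner (p : {poly C}) : circle_tame (fun z => p.[z]).
Proof.
elim/poly_ind: p => [|p c IH].
  by under eq_fun do rewrite horner0; exact: tame_cst.
under eq_fun do rewrite hornerMXaddC.
apply: tameD; last exact: tame_cst.
apply: tameM IH _; split; last by exists 1 => z ->.
by move=> z; exact: cvg_id.
Qed.

Lemma tame_mono (p q : {poly C}) : circle_tame (fun z => p.[z] * (q.[z])^* ).
Proof. by apply: tameM; [|apply: tame_conj]; exact: tame_horner. Qed.

Section Integral.
Variable mu : probability C R.
Hypothesis mu1 : mu unit_circle = 1%E.

Lemma mu_circleC : mu (~` unit_circle) = 0%E.
Proof. by rewrite probability_setC ?mu1 ?subee//; exact: measurable_circle. Qed.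

Lemma circle_integrable (f : C -> R) M : continuous f ->
  (forall z, `|z| = 1 -> `|f z| <= M) -> mu.-integrable setT (EFin \o f).
Proof.
move=> cf fM.
have mf := continuous_measurable_complex cf.
apply/(negligible_integrable _ _ _ mu_circleC) => //.
- by apply: measurableC; exact: measurable_circle.
- exact/measurable_EFinP.
rewrite setTD setCK; apply: measurable_bounded_integrable => //.
- exact: measurable_circle.
- by rewrite -[X in (X < _)%E]/(mu unit_circle) mu1 ltry.
- exact: measurable_funTS.
- exists M; split; first exact: num_real.
  by move=> x Mx z z1; apply: le_trans (fM _ z1) (ltW Mx).
Qed.

Lemma tame_Re f : circle_tame f ->
  mu.-integrable setT (EFin \o (fun z => complex.Re (f z))).
Proof.
move=> [cf [M fM]]; apply: (@circle_integrable _ (complex.Re M)).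
  by move=> z; apply: (@continuous_comp _ _ _ f); [exact: cf|exact: continuous_Re].
move=> z z1; rewrite -lecR.
have M0 : 0 <= M by apply: le_trans (fM _ z1).
by rewrite (nonneg_ReK M0); exact: le_trans (normc_ge_Re _) (fM _ z1).
Qed.

(** The imaginary part of [u] is the real part of [- i u]. *)
Lemma tame_Im f : circle_tame f ->
  mu.-integrable setT (EFin \o (fun z => complex.Im (f z))).
Proof.
move=> tf.
have -> : (fun z => complex.Im (f z)) = (fun z => complex.Re (Complex 0 (-1) * f z)).
  by apply/funext => z; case: (f z) => a b /=; rewrite mul0r mulN1r sub0r opprK.
by apply/tame_Re/tameM => //; exact: tame_cst.
Qed.

Lemma CintegralD f g : circle_tame f -> circle_tame g ->
  Cintegral mu (fun z => f z + g z) = Cintegral mu f + Cintegral mu g.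
Proof.
move=> tf tg; rewrite /Cintegral; simpc.
congr Complex; rewrite -RintegralD//.
- by apply: eq_Rintegral => z _; rewrite raddfD.
- exact: tame_Re.
- exact: tame_Re.
- by apply: eq_Rintegral => z _; rewrite raddfD.
- exact: tame_Im.
- exact: tame_Im.
Qed.

Lemma CintegralZ c f : circle_tame f ->
  Cintegral mu (fun z => c * f z) = c * Cintegral mu f.
Proof.
move=> tf; have tr := tame_Re tf; have ti := tame_Im tf.
have iZ k g (ig : mu.-integrable setT (EFin \o g)) :
    mu.-integrable setT (EFin \o (fun x => k * g x)) :=
  integrableZl measurableT k ig.
case: c => a b; rewrite /Cintegral; simpc.
rewrite -!RintegralZl// -RintegralB// -?RintegralD//.
- by congr Complex; apply: eq_Rintegral => z _; case: (f z) => x y.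
all: by first [exact: iZ tr|exact: iZ ti].
Qed.

Lemma Cintegral_conj f : circle_tame f ->
  Cintegral mu (fun z => (f z)^* ) = (Cintegral mu f)^*.
Proof.
move=> tf; rewrite /Cintegral.
rewrite -[(Complex _ _)^*]/(Complex _ _); congr Complex.
  by apply: eq_Rintegral => z _; case: (f z).
rewrite -mulN1r -RintegralZl//; last exact: tame_Im.
by apply: eq_Rintegral => z _; case: (f z) => a b /=; rewrite mulN1r.
Qed.

Lemma Cintegral_eq_circle f g : circle_tame f -> circle_tame g ->
  (forall z, `|z| = 1 -> f z = g z) -> Cintegral mu f = Cintegral mu g.
Proof.
move=> tf tg fg; rewrite /Cintegral /Rintegral; congr Complex; congr fine.
- rewrite (negligible_integral _ _ _ mu_circleC)//; first last.
  + exact: tame_Re.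
  + by apply: measurableC; exact: measurable_circle.
  rewrite [RHS](negligible_integral _ _ _ mu_circleC)//; first last.
  + exact: tame_Re.
  + by apply: measurableC; exact: measurable_circle.
  by rewrite setTD setCK; apply: eq_integral => z /set_mem/fg ->.
- rewrite (negligible_integral _ _ _ mu_circleC)//; first last.
  + exact: tame_Im.
  + by apply: measurableC; exact: measurable_circle.
  rewrite [RHS](negligible_integral _ _ _ mu_circleC)//; first last.
  + exact: tame_Im.
  + by apply: measurableC; exact: measurable_circle.
  by rewrite setTD setCK; apply: eq_integral => z /set_mem/fg ->.
Qed.

Definition poly_form (p q : {poly C}) : C :=
  Cintegral mu (fun z => p.[z] * (q.[z])^* ).

Lemma poly_form_lin c (p q r : {poly C}) :
  poly_form (c *: p + q) r = c * poly_form p r + poly_form q r.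
Proof.
rewrite /poly_form -CintegralZ; last exact: tame_mono.
rewrite -CintegralD; last exact: tame_mono.
  by congr Cintegral; apply/funext => z; rewrite hornerD hornerZ mulrDl mulrA.
by apply: tameM (tame_mono _ _); exact: tame_cst.
Qed.

Lemma poly_form_herm (p q : {poly C}) : poly_form q p = (poly_form p q)^*.
Proof.
rewrite /poly_form -Cintegral_conj; last exact: tame_mono.
by congr Cintegral; apply/funext => z; rewrite rmorphM /= conjCK mulrC.
Qed.

Lemma poly_formX (p q : {poly C}) : poly_form ('X * p) ('X * q) = poly_form p q.
Proof.
apply: Cintegral_eq_circle => [||z z1]; [exact: tame_mono..|].
rewrite !hornerM !hornerX rmorphM mulrACA -normCK.
by rewrite (z1 : `|z| = 1) expr1n mul1r.
Qed.

(** If the integral of [|p|^2] is 0, the open set where [p] does not vanish is null,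
    so the support is contained in the finite set of roots of [p]. *)
Lemma poly_form_gt0 (p : {poly C}) : infinite_set (supp mu) ->
  p != 0 -> 0 < poly_form p p.
Proof.
move=> inf p0; have tp := tame_mono p p.
pose f (z : C) : R := complex.Re (p.[z] * (p.[z])^* ).
have fE z : p.[z] * (p.[z])^* = (f z)%:C%C.
  by rewrite /f nonneg_ReK// mul_conjC_ge0.
have f0 z : 0 <= f z by rewrite -lecR -fE mul_conjC_ge0.
have -> : poly_form p p = (\int[mu]_z f z)%:C%C.
  rewrite /poly_form /Cintegral; congr Complex.
  rewrite -[RHS](mul0r (fine (mu setT))) -Rintegral_cst//.
  apply: eq_Rintegral => z _.
  by rewrite fE.
rewrite ltcR lt_neqAle Rintegral_ge0// andbT; apply/eqP => int0.
apply: inf.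
have cf : continuous f.
  move=> z; apply: (@continuous_comp _ _ _ (fun z => p.[z] * (p.[z])^* )).
    by case: tp => + _; apply.
  exact: continuous_Re.
have cp : continuous (fun z : C => p.[z]) by case: (tame_horner p).
pose U := [set z : C | p.[z] != 0].
have oU : open U.
  rewrite (_ : U = (fun z => p.[z]) @^-1` (~` [set 0])); last first.
    by apply/seteqP; split=> z; rewrite /U /= => /eqP.
  move/continuousP: cp; apply; apply: closed_openC.
  exact/accessible_closed_set1/hausdorff_accessible/norm_hausdorff.
have mf := continuous_measurable_complex cf.
have fint : (\int[mu]_z `|(f z)%:E| = 0)%E.
  under eq_integral do rewrite gee0_abs ?lee_fin//.
  rewrite -[LHS]fineK ?(integrable_fin_num measurableT (tame_Re tp))//.
  by rewrite -/(Rintegral _ _ _) -int0.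
have mEf : measurable_fun setT (EFin \o f) by exact/measurable_EFinP.
have [A [mA A0 UA]] := (ae_eq_integral_abs mu measurableT mEf).1 fint.
have U0 : mu U = 0%E.
  apply/eqP; rewrite -measure_le0 -A0; apply: le_measure; rewrite ?inE//.
    exact: open_measurable_complex.
  move=> z Uz; apply: UA => /= /(_ I) [] fz; move/negP: Uz; apply.
  have /eqP := fE z; rewrite fz -normCK expf_eq0 /= normr_eq0.
  by [].
have [rs pE] := closed_field_poly_normal p.
apply: (@sub_finite_set _ _ [set` rs]); last exact: finite_seq.
move=> z sz /=; have : ~ U z by move=> Uz; have := sz _ oU Uz; rewrite U0 ltxx.
move/negP; rewrite negbK pE hornerZ mulf_eq0 lead_coef_eq0 (negbTE p0)/=.
by rewrite -[_ == 0]/(root _ z) root_prod_XsubC.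
Qed.

(** The default value in the definition of [orthopoly] is excluded by the
    construction of an orthonormal sequence for the form. *)
Lemma circle_orthopoly : infinite_set (supp mu) ->
  form_orthonormal poly_form (orthopoly mu).
Proof.
move=> inf; rewrite /orthopoly; case: xgetP => [p _ []//|noex].
have [p pP] := orthonormal_exists poly_form_lin poly_form_herm
  (@poly_form_gt0^~ inf) poly_formX.
by have /(_ p)[] := noex.
Qed.

Lemma circle_verblunsky n : infinite_set (supp mu) ->
  verblunsky mu n = szego_coef poly_form n.
Proof.
move=> inf; exact: (orthonormal_verblunsky poly_form_lin poly_form_herm
  (@poly_form_gt0^~ inf) poly_formX (circle_orthopoly inf)).
Qed.

Lemma circle_ratio z n : infinite_set (supp mu) ->
  (forall k, unit_disk (verblunsky mu k)) -> 1 < `|z| ->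
  (orthopoly mu n).[z] / (orthopoly mu n.+1).[z] =
  ratio_step z^-1 (verblunsky mu n) (schur_iter z^-1 (verblunsky mu) n 1).
Proof.
move=> inf vD z1.
have -> : verblunsky mu = szego_coef poly_form.
  by apply/funext => k; exact: circle_verblunsky.
apply: (orthonormal_ratio poly_form_lin poly_form_herm
  (@poly_form_gt0^~ inf) poly_formX (circle_orthopoly inf)) => // k.
by rewrite -circle_verblunsky//; exact: vD.
Qed.

End Integral.
End CircleMeasure.

(** * Ratio asymptotics from matching coefficients *)

Section Convergence.
Variable R : realType.
Local Notation C := R[i].

Lemma cvg_real_complex (u : nat -> R) (l : R) :
  u @ \oo --> l -> ((u n)%:C)%C @[n --> \oo] --> (l%:C)%C.
Proof.
move=> ul; apply/cvgrPdist_lt => e e0; have eE := nonneg_ReK (ltW e0).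
have e1 : 0 < complex.Re e by rewrite -ltcR eE.
move/cvgrPdist_lt : ul => /(_ _ e1); apply: filterS => n un.
by rewrite -rmorphB /= normc_def /= expr0n addr0 sqrtr_sqr -eE ltcR.
Qed.

Lemma cvg_expr_complex (s : C) : 0 <= s -> s < 1 ->
  (s ^+ n) @[n --> \oo] --> (0 : C).
Proof.
move=> s0 s1; rewrite -(nonneg_ReK s0).
under eq_fun do rewrite -rmorphXn /=.
apply: (@cvg_real_complex _ 0); apply: cvg_expr.
rewrite ger0_norm; last by rewrite -lecR nonneg_ReK.
by rewrite -ltcR nonneg_ReK.
Qed.

Lemma cvg_exp_fact_complex (L : C) : 0 <= L ->
  (L ^+ n / (n`!)%:R) @[n --> \oo] --> (0 : C).
Proof.
move=> L0; rewrite -(nonneg_ReK L0).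
have -> : (fun n => ((complex.Re L)%:C)%C ^+ n / (n`!)%:R) =
    fun n => ((exp_coeff (complex.Re L) n)%:C)%C :> C.
  by apply/funext => n; rewrite /exp_coeff /= rmorphM rmorphXn fmorphV /= rmorph_nat.
exact: (@cvg_real_complex _ 0 (cvg_exp_coeff _)).
Qed.

Lemma cvg_sqrtC (u : nat -> C) : (forall n, 0 <= u n) ->
  u @ \oo --> (0 : C) -> sqrtC (u n) @[n --> \oo] --> (0 : C).
Proof.
move=> u0 uc; apply/cvgr0Pnorm_lt => e e0; near=> n.
rewrite ger0_norm ?sqrtC_ge0// -(@ltr_pXn2r _ 2)// ?nnegrE ?sqrtC_ge0 ?(ltW e0)//.
rewrite sqrtCK -[X in X < _]ger0_norm//; near: n.
by move/cvgr0Pnorm_lt: uc; apply; rewrite exprn_gt0.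
Unshelve. all: by end_near. Qed.

Lemma squeeze0C (u v : nat -> C) : (forall n, `|u n| <= v n) ->
  v @ \oo --> (0 : C) -> u @ \oo --> (0 : C).
Proof.
move=> uv vc; apply/cvgr0Pnorm_lt => e e0; near=> n.
apply: le_lt_trans (uv n) _; rewrite -[X in X < _]ger0_norm; last first.
  by apply: le_trans (uv n).
near: n; by move/cvgr0Pnorm_lt: vc; apply.
Unshelve. all: by end_near. Qed.

(** Between the two ratios stands the iteration that uses the coefficients [b] but
    starts from the value reached by [a] after [M k] steps: [schur_iter_dist] compares
    it with the first, [schur_iter_contract] with the second. *)
Lemma ratio_step_cvg (a b : nat -> C) (M : nat -> nat) (z : C) : 1 < `|z| ->
  (forall k, `|a k| < 1) -> (forall k, `|b k| < 1) ->
  (forall k j, (j <= k)%N -> `|a (M k + j)%N - b j| <= (k`!)%:R^-1) ->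
  (ratio_step z^-1 (a (M k + k)%N) (schur_iter z^-1 a (M k + k) 1)
   - ratio_step z^-1 (b k) (schur_iter z^-1 b k 1)) @[k --> \oo] --> (0 : C).
Proof.
move=> z1 a1 b1 ab; set w := z^-1.
have w1 : `|w| < 1 by rewrite normfV invf_lt1// (lt_trans _ z1).
have s0 : 0 < 1 - `|w| by rewrite subr_gt0.
have w2 : 0 < 1 - `|w| ^+ 2 by rewrite subr_gt0 expr_lt1.
set L := 4 / (1 - `|w|); set c := 2 / (1 - `|w| ^+ 2).
have L0 : 0 <= L by rewrite divr_ge0 ?ler0n ?ltW.
have c0 : 0 <= c by rewrite divr_ge0 ?ltW.
(* the summands: mismatch of the top coefficient (written with 1 ^+ k to have the
   shape of the next one), accumulated mismatch, and memory of the start *)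
pose e k := 1 ^+ k / (k`!)%:R + L ^+ k / (k`!)%:R + `|w| ^+ k * c.
have t1 k : 0 <= 1 ^+ k / (k`!)%:R :> C by rewrite expr1n mul1r invr_ge0 ler0n.
have t2 k : 0 <= L ^+ k / (k`!)%:R by rewrite divr_ge0 ?exprn_ge0 ?ler0n.
have t3 k : 0 <= `|w| ^+ k * c by rewrite mulr_ge0 ?exprn_ge0.
have e0 k : 0 <= e k by rewrite !addr_ge0.
have ec : e @ \oo --> (0 : C).
  rewrite -[0]addr0 -[X in X + 0]addr0; apply: cvgD; first apply: cvgD.
  - exact: cvg_exp_fact_complex ler01.
  - exact: cvg_exp_fact_complex.
  - rewrite -(mul0r c); apply: cvgMr_tmp; exact: cvg_expr_complex.
apply: (@squeeze0C _ (fun k => 2 / (1 - `|w|) ^+ 2 * (sqrtC (2 * e k) + e k))).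
  move=> k; apply: ratio_step_dist => //.
  - by apply: schur_iter_le1; rewrite ?normr1.
  - by apply: schur_iter_le1; rewrite ?normr1.
  - apply: le_trans (ab k k (leqnn k)) _.
    by rewrite /e expr1n mul1r -addrA lerDl addr_ge0.
  rewrite schur_iter_add; set g := schur_iter w a (M k) 1.
  have g1 : `|g| <= 1 by apply: schur_iter_le1; rewrite ?normr1.
  have f0 : 0 <= (k`!)%:R^-1 :> C by rewrite invr_ge0 ler0n.
  have one1 : `|1 : C| <= 1 by rewrite normr1.
  have d1 := schur_iter_dist w1 (fun j => a1 (M k + j)%N) b1 g1 f0
    (fun j jk => ab k j (ltnW jk)).
  have d2 := schur_iter_contract k w1 b1 g1 one1.
  rewrite -[X in `|X|](subrKA (schur_iter w b k g)).
  apply: le_trans (ler_normD _ _) _; apply: le_trans (lerD d1 d2) _.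
  by rewrite /e -addrA lerDr t1.
rewrite -(mulr0 (2 / (1 - `|w|) ^+ 2)); apply: cvgMl_tmp.
rewrite -[0]addr0; apply: cvgD => //; apply: cvg_sqrtC.
  by move=> k; rewrite mulr_ge0.
by rewrite -(mulr0 2); apply: cvgMl_tmp.
Qed.
End Convergence.

(** * Recurrence of patterns in an i.i.d. sequence *)

Section Blocks.
Context d d' (Omega : measurableType d) (T : measurableType d').
Variables (R : realType) (P : probability Omega R) (tau : probability T R).
Variable X : nat -> {RV P >-> T}.
Hypothesis Xiid : iid_with_law tau X.

Definition cylinder (V : nat -> set T) (J : seq nat) : set Omega :=
  \bigcap_(j in [set` J]) (X j @^-1` V j).

Lemma measurable_RV_preimage (Y : {RV P >-> T}) (A : set T) :
  measurable A -> measurable (Y @^-1` A).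
Proof. by move=> mA; rewrite -[_ @^-1` _]setTI; exact: measurable_funP. Qed.

Lemma measurable_cylinder V J : (forall j, measurable (V j)) ->
  measurable (cylinder V J).
Proof.
move=> mV; apply: bigcap_measurableType => j _.
exact: measurable_RV_preimage.
Qed.

Lemma cylinder_cat V J K :
  cylinder V (J ++ K) = cylinder V J `&` cylinder V K.
Proof.
apply/seteqP; split=> [w H|w [HJ HK] j /=].
  by split=> j /= jJ; apply: H => /=; rewrite mem_cat jJ ?orbT.
by rewrite mem_cat => /orP[/HJ|/HK].
Qed.

Lemma cylinder_prob V J : (forall j, measurable (V j)) -> uniq J ->
  P (cylinder V J) = (\prod_(j <- J) fine (tau (V j)))%:E.
Proof.
move=> mV uJ; have [indep law] := Xiid.
rewrite (indep _ _ uJ mV) -prodEFin; apply: eq_bigr => j _.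
by rewrite fineK ?fin_num_measure// -(law j _ (mV j)).
Qed.

(** Independence of the complements of block events, from the product rule for
    cylinders.  The induction on [K] subtracts: the probability without
    block [K] is the one with no condition on that block minus the one with block
    [K] realized, and in the latter block [K] joins the cylinder [J].  This is why
    an arbitrary cylinder beyond the blocks is carried along. *)
Lemma no_block_prob (V : nat -> set T) (N n K : nat) (p : R) (J : seq nat) :
  (forall j, measurable (V j)) ->
  (forall i, \prod_(j <- iota (N + i * n) n) fine (tau (V j)) = p) ->
  uniq J -> (forall j, j \in J -> (N + K * n <= j)%N) ->
  P ((\bigcap_(i < K) ~` cylinder V (iota (N + i * n) n)) `&` cylinder V J) =
  ((1 - p) ^+ K * \prod_(j <- J) fine (tau (V j)))%:E.
Proof.
move=> mV pE; elim: K J => [|K IH] J uJ NJ.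
  by rewrite bigcap_mkord big_ord0 setTI mul1r cylinder_prob.
have mB i : measurable (cylinder V (iota (N + i * n) n)) by exact: measurable_cylinder.
set G := \bigcap_(i < K) ~` cylinder V (iota (N + i * n) n) in IH.
set B := cylinder V (iota (N + K * n) n).
have mG : measurable G.
  by apply: bigcap_measurableType => i _; exact: measurableC.
have mC := measurable_cylinder J mV.
rewrite (_ : _ `&` _ = (G `&` cylinder V J) `\` B); last first.
  by rewrite IIS bigcap_setU bigcap_set1 setDE -/G -/B setIAC.
have NJ' j : j \in J -> (N + K * n <= j)%N.
  by move=> /NJ; apply: leq_trans; rewrite leq_add2l mulSn leq_addl.
have mGC : measurable (G `&` cylinder V J) by exact: measurableI.
have mBK : measurable B := mB K.
rewrite measureD//; last first.
  exact: le_lt_trans (probability_le1 P mGC) (ltry 1).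
rewrite -setIA [cylinder V J `&` B]setIC -cylinder_cat.
rewrite -[LHS]/(P _ - P _)%E !IH//.
- rewrite big_cat/= pE -EFinB; congr EFin.
  by rewrite exprS; ring.
- rewrite cat_uniq iota_uniq uJ andbT /=; apply/hasPn => j /NJ jN.
  rewrite mem_iota negb_and -leqNgt; apply/orP; right.
  by rewrite -addnA -mulSnr.
- move=> j; rewrite mem_cat => /orP[|/NJ'//].
  by rewrite mem_iota => /andP[].
Qed.

Lemma expr_squeeze0 (x q : R) : 0 <= q -> q < 1 ->
  (forall n, x <= q ^+ n) -> x <= 0.
Proof.
move=> q0 q1 xq; have qc : (q ^+ n) @[n --> \oo] --> (0 : R).
  by apply: cvg_expr; rewrite ger0_norm.
by apply: (cvgr_to_ge qc); apply: nearW => n; exact: xq.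
Qed.

(** The blocks of length [n] starting at [N], [N + n], [N + 2n], ... are independent and
    each realizes the pattern with the same probability [p > 0], so that none of
    the first [K] does with probability [(1 - p)^K]. *)
Lemma pattern_recurs (n N : nat) (U : nat -> set T) :
  (forall j, measurable (U j)) -> (forall j, (j < n)%N -> (0 < tau (U j))%E) ->
  {ae P, forall w, exists2 M, (N <= M)%N &
    forall j, (j < n)%N -> U j (X (M + j) w)}.
Proof.
(* periodic extension, so that every block is a cylinder over one family *)
move=> mU U0; pose V k := U ((k - N) %% n)%N.
have mV j : measurable (V j) by exact: mU.
pose p := \prod_(j <- iota 0 n) fine (tau (U j)).
have VE i j : (j < n)%N -> V (N + i * n + j)%N = U j.
  by move=> jn; rewrite /V -addnA addKn modnMDl modn_small.
have pE i : \prod_(j <- iota (N + i * n) n) fine (tau (V j)) = p.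
  rewrite -[X in iota X]addn0 iotaDl big_map /p !big_seq.
  by apply: eq_bigr => j; rewrite mem_iota => /andP[_ jn]; rewrite VE.
have p0 : 0 < p.
  rewrite /p big_seq prodr_gt0// => j; rewrite mem_iota => /andP[_ jn].
  by rewrite fine_gt0// U0//= (le_lt_trans (probability_le1 _ (mU j)))// ltry.
have p1 : p <= 1.
  rewrite /p; apply: prodr_ile1 => j _; rewrite fine_ge0//=.
  by rewrite -lee_fin fineK ?fin_num_measure// probability_le1.
pose B i := cylinder V (iota (N + i * n) n).
have mB i : measurable (B i) by exact: measurable_cylinder.
pose E := \bigcap_i ~` B i.
have mE : measurable E by apply: bigcap_measurableType => i _; exact: measurableC.
exists E; split=> //; last first.
  move=> w /= noM i _ Bi; apply: noM; exists (N + i * n)%N; first exact: leq_addr.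
  move=> j jn; rewrite -(VE i j jn); apply: Bi.
  by rewrite /= mem_iota leq_addr ltn_add2l.
have leE K : fine (P E) <= (1 - p) ^+ K.
  rewrite -lee_fin fineK ?fin_num_measure//.
  have := @no_block_prob V N n K p [::] mV pE isT.
  rewrite big_nil mulr1 => <- //.
  apply: le_measure; rewrite ?inE//.
    apply: measurableI; last exact: measurable_cylinder.
    by apply: bigcap_measurableType => i _; apply: measurableC; exact: (mB i).
  move=> w Ew; split; last by [].
  by move=> i _; exact: Ew.
apply/eqP; rewrite -measure_le0 -[X in (X <= _)%E]fineK ?fin_num_measure// lee_fin.
by apply: (@expr_squeeze0 _ (1 - p)) => //; rewrite ?subr_ge0// ltrBlDr ltrDl.
Qed.

End Blocks.

(** * Simultaneous approximation of all sequences in the support *)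

Section RationalBalls.
Variable R : realType.
Local Notation C := R[i].

Definition rat_complex (q : rat * rat) : C := Complex (ratr q.1) (ratr q.2).

Lemma open_normball (c e : C) : open [set z : C | `|z - c| < e].
Proof.
rewrite openE => z /= ze; apply/nbhs_normP.
exists (e - `|z - c|) => [|t /= zt]; first by rewrite /= subr_gt0.
rewrite -(subrKA z) (le_lt_trans (ler_normD _ _))//.
by rewrite -ltrBrDr distrC.
Qed.

Lemma norm_complex_le (a b : R) : `|Complex a b| <= ((`|a| + `|b|)%:C)%C :> C.
Proof.
rewrite normc_def lecR /= -[leRHS]ger0_norm ?addr_ge0// -sqrtr_sqr ler_wsqrtr//.
by rewrite sqrrD !real_normK ?num_real// addrAC lerDl mulrn_wge0 ?mulr_ge0.
Qed.

Lemma rat_complex_dense (z e : C) : 0 < e -> exists q, `|z - rat_complex q| < e.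
Proof.
move=> e0; have eE := nonneg_ReK (ltW e0); set r := complex.Re e in eE.
have r0 : 0 < r / 2 by rewrite divr_gt0 // -ltcR eE.
have dense (x : R) : exists q : rat, `|x - ratr q| < r / 2.
  have xr : x - r / 2 < x + r / 2 by rewrite ltrD2l gtrN.
  have [q] := rat_in_itvoo xr; rewrite in_itv/= => qx.
  by exists q; rewrite distrC ltr_distl.
case: z => a b; have [p ap] := dense a; have [q bq] := dense b.
exists (p, q); rewrite /rat_complex; simpc.
apply: le_lt_trans (norm_complex_le _ _) _.
by rewrite -eE ltcR [r]splitr ltrD.
Qed.

Variables (d : measure_display) (Omega : measurableType d)
  (P : probability Omega R) (tau : probability C R) (X : nat -> {RV P >-> C}).
Hypothesis Xiid : iid_with_law tau X.

Lemma ae_countable (I : countType) (Q : I -> Omega -> Prop) :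
  (forall i, {ae P, forall w, Q i w}) -> {ae P, forall w, forall i, Q i w}.
Proof.
move=> aeQ.
have : {ae P, forall w, forall n, if unpickle n is Some i then Q i w else True}.
  apply/ae_foralln => n; case: unpickle => [i|]; first exact: aeQ.
  exact: aeW.
by apply: filterS => w H i; have := H (pickle i); rewrite pickleK.
Qed.

(** The null set must not depend on [b], and there are uncountably many [b].  So
    recurrence is first obtained for the countably many patterns of balls
    with rational centres; a given [b] is then approximated by rational centres,
    and half the tolerance is spent on each of the two approximations. *)
Lemma supp_pattern_recurs : {ae P, forall w, forall b : nat -> C,
  (forall n, supp tau (b n)) -> forall N n k : nat,
  exists2 M, (N <= M)%N & forall j, (j < n)%N -> `|X (M + j)%N w - b j| <= k.+1%:R^-1}.
Proof.
(* the index i consists of the starting bound N, the precision k, and the centres *)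
pose U (i : nat * nat * seq (rat * rat)) (j : nat) : set C :=
  [set z | `|z - rat_complex (nth 0 i.2 j)| < (2 * i.1.2.+1%:R)^-1].
pose Q i w := (forall j, (j < size i.2)%N -> (0 < tau (U i j))%E) ->
  exists2 M, (i.1.1 <= M)%N &
    forall j, (j < size i.2)%N -> U i j (X (M + j)%N w).
have aeQ i : {ae P, forall w, Q i w}.
  have [H|H] := pselect (forall j, (j < size i.2)%N -> (0 < tau (U i j))%E); last first.
    by apply: aeW => w /H.
  have mU j : measurable (U i j).
    by apply: open_measurable_complex; exact: open_normball.
  have Hp := pattern_recurs Xiid i.1.1 mU H.
  by apply: filterS Hp => w Hw _.
have := ae_countable aeQ; apply: filterS => w Hw b bs N n k.
have e0 : 0 < (2 * k.+1%:R)^-1 :> C by rewrite invr_gt0 mulr_gt0 ?ltr0n.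
have /choice[q qb] : forall j, exists q, `|b j - rat_complex q| < (2 * k.+1%:R)^-1.
  by move=> j; exact: rat_complex_dense.
have szq : size (mkseq q n) = n by rewrite size_mkseq.
have [|M NM HM] := Hw (N, k, mkseq q n).
  move=> j /=; rewrite szq => jn; apply: (bs j); first exact: open_normball.
  by rewrite /U /= nth_mkseq.
exists M => // j jn; have := HM j; rewrite /= szq => /(_ jn).
rewrite /U /= nth_mkseq// => Xq.
rewrite -(subrKA (rat_complex (q j))) (le_trans (ler_normD _ _))//.
have -> : k.+1%:R^-1 = (2 * k.+1%:R)^-1 + (2 * k.+1%:R)^-1 :> C.
  by rewrite -mulr2n -[RHS]mulr_natl invfM mulrA divff ?mul1r ?pnatr_eq0.
by rewrite lerD ?ltW// distrC.
Qed.

Lemma ae_in_disk : tau unit_disk = 1%E ->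
  {ae P, forall w, forall n, unit_disk (X n w)}.
Proof.
move=> tau1; apply/ae_foralln => n.
have mD : measurable (@unit_disk R).
  have := @open_normball 0 1.
  rewrite (_ : [set z | _] = unit_disk); first exact: open_measurable_complex.
  by apply/seteqP; split=> z; rewrite /unit_disk /mkset subr0.
exists (X n @^-1` (~` unit_disk)); split => //.
- exact/measurable_RV_preimage/measurableC.
rewrite -[LHS]/(distribution P (X n) (~` unit_disk)).
rewrite (Xiid.2 n) ?probability_setC ?tau1 ?subee//; exact: measurableC.
Qed.

End RationalBalls.

Theorem theorem4p1 (R : realType) (d : measure_display)
    (Omega : measurableType d) (P : probability Omega R)
    (tau : probability R[i] R) (tau_disk : tau unit_disk = 1%E)
    (alpha : nat -> {RV P >-> R[i]}) (alpha_iid : iid_with_law tau alpha)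
    (mu : Omega -> probability R[i] R)
    (mu_alpha : {ae P, forall w, circle_measure (mu w) /\
                                 forall n, verblunsky (mu w) n = alpha n w}) :
  {ae P, forall w, forall nu : probability R[i] R, classK tau nu ->
    exists m : nat -> nat, {homo m : i j / (i < j)%N} /\
      forall z : R[i], 1 < `|z| ->
        ((orthopoly (mu w) (m n).-1).[z] / (orthopoly (mu w) (m n)).[z]
         - (orthopoly nu n.-1).[z] / (orthopoly nu n).[z])
          @[n --> \oo] --> (0 : R[i])}.
Proof.
have := supp_pattern_recurs alpha_iid; have := ae_in_disk alpha_iid tau_disk.
apply: filterS3 mu_alpha => w [[mu1 muinf] vmu] aD rec nu [[nu1 nuinf] vnu].
have bS n : supp tau (verblunsky nu n) by have [] := vnu n.
have bD n : unit_disk (verblunsky nu n) by have [] := vnu n.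
have vD n : unit_disk (verblunsky (mu w) n) by rewrite vmu; exact: aD.
have {rec bS} rec (Nk : nat * nat) : exists M, (Nk.1 <= M)%N /\
    forall j, (j <= Nk.2)%N ->
      `|verblunsky (mu w) (M + j)%N - verblunsky nu j| <= ((Nk.2)`!)%:R^-1.
  have [M NM HM] := rec _ bS Nk.1 Nk.2.+1 (Nk.2)`!.-1; exists M; split => // j jk.
  by rewrite vmu; have := HM _ jk; rewrite prednK ?fact_gt0.
have {rec}[g gP] := choice rec.
(* Each M k.+1 is looked for from M k on, so that M k + k + 1 increases strictly. *)
pose M := fix M k := if k is k'.+1 then g ((M k'), k'.+1) else g (0%N, 0%N).
have MS k : (M k <= M k.+1)%N by have [] := gP (M k, k.+1).
have Mab k j : (j <= k)%N ->
    `|verblunsky (mu w) (M k + j)%N - verblunsky nu j| <= (k`!)%:R^-1.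
  by case: k => [|k]; [have [_] := gP (0, 0)%N|have [_] := gP (M k, k.+1)]; apply.
(* The ratio with indices n.-1 and n has top coefficient number n.-1, so the index
   n = k + 1 is matched with M k + k + 1; a limit only sees the n >= 1. *)
exists (fun n => if n is k.+1 then (M k + k).+1 else 0%N); split.
  by apply: homo_ltn ltn_trans _ => -[|k]//; rewrite ltnS addnS ltnS leq_add2r.
move=> z z1; rewrite -cvg_shiftS.
apply: cvg_trans (ratio_step_cvg z1 vD bD Mab).
by apply: near_eq_cvg; apply: nearW => k /=; rewrite -!circle_ratio.
Qed.
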